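(* Let $t>1$ be an odd natural number, $n=2t+1$, and let $k$ be a natural number with $\gcd(k,n)=1$. Then the inverse $(2^t+2^{(3t+1)/2}-1)^{-1}$ modulo $2^n-1$ of the odd Niho exponent is never cyclotomic equivalent to $e(l,k)$ over $\mathbb{F}_{2^n}$, for any natural number $l$.
   Context: For natural numbers $l,k$, $e(l,k)=\sum_{j=0}^{l-1}2^{jk}$. Two exponents $d,e$ are cyclotomic equivalent over $\mathbb{F}_{2^n}$ if there is a natural number $a$ with $2^a d\equiv e\pmod{2^n-1}$, or (when $\gcd(d,2^n-1)=1$) $2^a d^{-1}\equiv e\pmod{2^n-1}$, where $d^{-1}$ is the inverse of $d$ modulo $2^n-1$. *)

(* Defs.v *)
From mathcomp Require Import all_boot.

Set Implicit Arguments.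
Unset Strict Implicit.
Unset Printing Implicit Defensive.

Definition e (l k : nat) : nat := \sum_(0 <= j < l) 2 ^ (j * k).

(* The residue in [0, m) inverse to d modulo m, given by the Bezout coefficient
   of d; it is only meaningful when d and m are coprime, see inv_modP. *)
Definition inv_mod (d m : nat) : nat := (egcdn d m).1 %% m.

Lemma inv_modP (d m : nat) :
  coprime d m -> d * inv_mod d m = 1 %[mod m].
Proof.
case: d => [|d] cop.
  by move: cop; rewrite /coprime gcd0n => /eqP ->; rewrite !modn1.
rewrite /inv_mod modnMmr; case: egcdnP => //= u v def_u _.
by rewrite mulnC def_u (eqP cop) modnMDl.
Qed.

Definition cyclotomic_equiv (n d d' : nat) : Prop :=
  exists a : nat,
    2 ^ a * d = d' %[mod 2 ^ n - 1] \/
    (coprime d (2 ^ n - 1) /\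
     2 ^ a * inv_mod d (2 ^ n - 1) = d' %[mod 2 ^ n - 1]).

Definition niho_odd (t : nat) : nat := 2 ^ t + 2 ^ ((3 * t + 1) %/ 2) - 1.

(* Main.v *)
(** Put t = 2s + 1, so n = 4s + 3, and let d be the odd Niho exponent.  Exponents
    of 2 live in Z/n, and a residue modulo 2^n - 1 other than 0 has a unique set of
    binary digits in Z/n.  The digit set of e(l,k) is an arithmetic progression
    of difference k, i.e. the preimage of an interval [0, r) under an affine
    bijection x |-> u x + v of Z/n.  For such a set the number of i in it with
    i + c outside of it is min(m, n - m, r, n - r), where m = u c mod n.

    From d (1 + 2^(2s+2) + 2^(3s+2)) = 3 * 2^s mod 2^n - 1 one reads off the digits
    of the inverse of d, up to rotation: they are made of two alternating blocks
    and a block of zeros.  The counts for c = 1 and c = 2 then contradict the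
    formula, both for this set and for the digits {0, ..., 2s, 3s + 2} of d. *)

Require Import Defs.
From mathcomp Require Import all_boot.
From mathcomp Require Import zify.

Set Implicit Arguments.
Unset Strict Implicit.
Unset Printing Implicit Defensive.

(** * Sums over Z/n *)

Lemma eq_mod_sum (n m : nat) (F G : 'I_n -> nat) :
  (forall i, F i = G i %[mod m]) ->
  \sum_(i < n) F i = \sum_(i < n) G i %[mod m].
Proof.
by move=> FG; rewrite -modn_summ -[RHS]modn_summ; congr (_ %% m); apply: eq_bigr.
Qed.

Lemma modn_mul2l_inj (u m x y : nat) :
  coprime u m -> u * x = u * y %[mod m] -> x = y %[mod m].
Proof.
move=> cop eq_uxy.
have inv_u z : inv_mod u m * (u * z) = z %[mod m].
  by rewrite mulnA -modnMml [_ * u]mulnC inv_modP // modnMml mul1n.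
by rewrite -inv_u -[RHS]inv_u -modnMmr eq_uxy modnMmr.
Qed.

Lemma modn_addl_small (n i c : nat) :
  i < n -> c <= n -> (i + c) %% n = if i + c < n then i + c else i + c - n.
Proof.
move=> lt_in le_cn; case: ltnP => H; first by rewrite modn_small.
by rewrite -{1}(subnK H) modnDr modn_small //; lia.
Qed.

(** For [u] prime to [n], the map i |-> u i + v permutes Z/n. *)
Lemma sum_affine (n u v : nat) (F : nat -> nat) : coprime u n ->
  \sum_(i < n) F ((u * i + v) %% n) = \sum_(i < n) F i.
Proof.
case: n => [|n] cop; first by rewrite !big_ord0.
pose h (i : 'I_n.+1) : 'I_n.+1 := Ordinal (ltn_pmod (u * i + v) (ltn0Sn n)).
rewrite [RHS](reindex_inj (h := h)) //= => i j /(congr1 val) /= /eqP.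
rewrite eqn_modDr => /eqP /(modn_mul2l_inj cop).
by rewrite !modn_small // => /val_inj.
Qed.

Lemma sum_indicator_interval (n a b : nat) : b <= n ->
  \sum_(i < n) (a <= i < b) = b - a.
Proof.
move=> le_bn; rewrite -(big_mkord xpredT (fun i => nat_of_bool (a <= i < b))).
elim: n b le_bn => [|n IHn] b le_bn; first by rewrite big_geq //; lia.
rewrite big_nat_recr //=; move: le_bn; rewrite leq_eqVlt => /orP[/eqP->|le_bn].
  rewrite (eq_big_nat _ _ (F2 := fun i => nat_of_bool (a <= i < n))) => [|i Hi].
    by rewrite IHn //; lia.
  by congr nat_of_bool; lia.
by rewrite IHn //; lia.
Qed.

Lemma sum_indicator_point (n j : nat) : \sum_(i < n) (i == j :> nat) = (j < n).
Proof.
case: (ltnP j n) => [lt_jn|le_nj].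
  under eq_bigr => i _ do have -> : (i == j :> nat) = (j <= i < j.+1) by lia.
  by rewrite sum_indicator_interval //; lia.
rewrite big1 // => i _; have := ltn_ord i; lia.
Qed.

Lemma sum_indicator_seq (n : nat) (s : seq nat) :
  uniq s -> all (fun j => j < n) s -> \sum_(i < n) (nat_of_ord i \in s) = size s.
Proof.
elim: s => [|x s IHs] /=; first by rewrite big1.
move=> /andP[x_s uniq_s] /andP[lt_xn lt_sn].
transitivity (\sum_(i < n) ((i == x :> nat) + (nat_of_ord i \in s))).
  apply: eq_bigr => i _; rewrite inE; case: eqVneq => // ->.
  by rewrite (negbTE x_s).
by rewrite big_split /= sum_indicator_point lt_xn IHs.
Qed.

Lemma sum_eq_size (n : nat) (P : nat -> bool) (s : seq nat) :
  uniq s -> all (fun j => j < n) s -> (forall i, i < n -> P i = (i \in s)) ->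
  \sum_(i < n) P i = size s.
Proof.
move=> uniq_s lt_sn PE; rewrite -(sum_indicator_seq uniq_s lt_sn).
by apply: eq_bigr => i _; rewrite PE.
Qed.

Lemma sum_ge_size (n : nat) (P : nat -> bool) (s : seq nat) :
  uniq s -> all (fun j => j < n) s -> all P s -> size s <= \sum_(i < n) P i.
Proof.
move=> uniq_s lt_sn Ps; rewrite -(sum_indicator_seq uniq_s lt_sn).
by apply: leq_sum => i _; case: (boolP (_ \in s)) => // /(allP Ps) ->.
Qed.

(** * Binary digits modulo 2^n - 1 *)

Definition bitsum (n : nat) (f : nat -> bool) : nat := \sum_(i < n) f i * 2 ^ i.

Lemma bitsumS (n : nat) (f : nat -> bool) :
  bitsum n.+1 f = bitsum n f + f n * 2 ^ n.
Proof. by rewrite /bitsum big_ord_recr. Qed.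

Lemma bitsumC (n : nat) (f : nat -> bool) :
  bitsum n f + bitsum n (fun i => ~~ f i) = 2 ^ n - 1.
Proof.
elim: n => [|n IHn]; first by rewrite /bitsum !big_ord0.
rewrite !bitsumS expnS.
by have : 0 < 2 ^ n by [rewrite expn_gt0]; case: (f n); lia.
Qed.

Lemma bitsum_trunc (m n : nat) (f : nat -> bool) :
  m <= n -> (forall i, m <= i < n -> ~~ f i) -> bitsum n f = bitsum m f.
Proof.
elim: n => [|n IHn]; first by rewrite leqn0 => /eqP->.
rewrite leq_eqVlt => /orP[/eqP-> //|le_mn] f0.
rewrite bitsumS (negbTE (f0 n _)) ?addn0 ?leqnn ?andbT //.
by apply: IHn => // i /andP[le_mi lt_in]; rewrite f0 // le_mi ltnW.
Qed.

Lemma bitsum_ones (n : nat) (f : nat -> bool) :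
  (forall i, i < n -> f i) -> bitsum n f = 2 ^ n - 1.
Proof.
move=> f1; rewrite -(bitsumC n f) [X in _ + X]big1 ?addn0 // => i _.
by rewrite f1.
Qed.

(* The summands 2 ^ (_ + (odd a != b)) are those of a geometric sum of ratio 4
   starting at the first i >= a of parity b. *)
Lemma bitsum_alternate (a m : nat) (b : bool) (f : nat -> bool) :
  (forall i, a <= i < a + 2 * m -> f i = (odd i == b)) ->
  3 * bitsum (a + 2 * m) f + 2 ^ (a + (odd a != b)) =
  3 * bitsum a f + 2 ^ (a + 2 * m + (odd a != b)).
Proof.
elim: m => [|m IHm] fE; first by rewrite muln0 addn0.
have -> : a + 2 * m.+1 = (a + 2 * m).+2 by lia.
have {}IHm := IHm (fun i Hi => fE i ltac:(lia)).
rewrite !bitsumS !fE; try lia.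
have -> : odd (a + 2 * m).+1 = ~~ odd a by lia.
have -> : odd (a + 2 * m) = odd a by lia.
by move: IHm; case: (odd a); case: b {fE}; rewrite /= ?addn0 ?addn1 ?addSn ?expnS; lia.
Qed.

Lemma bitsum_gt0 (n i : nat) (f : nat -> bool) : i < n -> f i -> 0 < bitsum n f.
Proof.
move=> lt_in fi; rewrite /bitsum (bigD1 (Ordinal lt_in)) //= fi mul1n.
by rewrite addn_gt0 expn_gt0.
Qed.

Lemma bitsum_inj (n : nat) (f g : nat -> bool) :
  bitsum n f = bitsum n g -> forall i, i < n -> f i = g i.
Proof.
elim: n => // n IHn; rewrite !bitsumS => eq_fg.
have := bitsumC n f; have := bitsumC n g => Hg Hf.
have pos : 0 < 2 ^ n by rewrite expn_gt0.
have eq_n : f n = g n by move: eq_fg; case: (f n); case: (g n); lia.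
move=> i; rewrite ltnS leq_eqVlt => /orP[/eqP-> //|]; apply: IHn.
by move: eq_fg; rewrite eq_n => /addIn.
Qed.

(** Only the residue 0 has two digit strings, all zeros and all ones. The set digit [i] and the
    clear digit [j] of [f] exclude both. *)
Lemma bitsum_mod_inj (n i j : nat) (f g : nat -> bool) :
  i < n -> f i -> j < n -> ~~ f j ->
  bitsum n f = bitsum n g %[mod 2 ^ n - 1] -> forall h, h < n -> f h = g h.
Proof.
move=> lt_in fi lt_jn fj eq_fg; apply: bitsum_inj.
have f_gt0 := bitsum_gt0 lt_in fi.
have := bitsum_gt0 (f := fun i => ~~ f i) lt_jn fj.
have := bitsumC n f; have := bitsumC n g => Hg Hf nf_gt0.
move: eq_fg; rewrite modn_small; last by lia.
case: (ltnP (bitsum n g) (2 ^ n - 1)) => H; first by rewrite modn_small.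
have -> : bitsum n g = 2 ^ n - 1 by lia.
by rewrite modnn; lia.
Qed.

Lemma expn2_modD (n i j : nat) : 2 ^ (i + n * j) = 2 ^ i %[mod 2 ^ n - 1].
Proof.
rewrite expnD expnM -modnMmr -modnXm.
have -> : 2 ^ n = 1 %[mod 2 ^ n - 1].
  by rewrite -{1}(subnK (expn_gt0 2 n : 1 <= 2 ^ n)) modnDl.
by rewrite modnXm exp1n modnMmr muln1.
Qed.

Lemma expn2_mod (n i : nat) : 2 ^ (i %% n) = 2 ^ i %[mod 2 ^ n - 1].
Proof. by rewrite {2}(divn_eq i n) addnC [_ * n]mulnC expn2_modD. Qed.

(** * Digits of [e l k] *)

(** An arithmetic progression in Z/n with [r] terms, whose difference is the inverse of [u]. *)
Definition affine_interval (n : nat) (f : nat -> bool) (u v r : nat) : Prop :=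
  [/\ coprime u n, r <= n & forall i, i < n -> f i = ((u * i + v) %% n < r)].

(** The exponents j k run once through Z/n, so the sum is 2^n - 1. Hence [l] only matters modulo
    [n], and for l < n the exponents are distinct digits. *)
Lemma e_full (n k : nat) : coprime k n -> e n k = 0 %[mod 2 ^ n - 1].
Proof.
move=> cop; rewrite /e big_mkord.
rewrite (eq_mod_sum (G := fun j : 'I_n => 2 ^ ((k * j + 0) %% n))) => [|j].
  rewrite (sum_affine 0 (fun i => 2 ^ i) cop).
  have := bitsumC n xpredT; rewrite /bitsum [X in _ + X]big1 // addn0.
  by under eq_bigr => i _ do rewrite mul1n; move=> ->; rewrite modnn mod0n.
by rewrite addn0 expn2_mod mulnC.
Qed.

Lemma e_mod (n l k : nat) : coprime k n -> e (l %% n) k = e l k %[mod 2 ^ n - 1].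
Proof.
move=> cop; rewrite {2}(divn_eq l n); elim: (l %/ n) => [|q IHq] //.
rewrite IHq mulSn -addnA; set l' := q * n + _.
rewrite /e (big_cat_nat (leq0n n) (leq_addr _ _)) /=.
rewrite -modnDml e_full // modnDml add0n.
have -> : \sum_(n <= j < n + l') 2 ^ (j * k) = \sum_(0 <= j < l') 2 ^ ((j + n) * k).
  by rewrite -{1}[n]add0n big_addn addKn.
rewrite -modn_summ -[RHS]modn_summ; congr (_ %% _); apply: eq_bigr => j _.
by rewrite mulnDl expn2_modD.
Qed.

Lemma bitsum_e_affine (n k l a i j : nat) (f : nat -> bool) :
  coprime k n -> i < n -> f i -> j < n -> ~~ f j ->
  2 ^ a * bitsum n f = e l k %[mod 2 ^ n - 1] ->
  exists u v r, affine_interval n f u v r.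
Proof.
move=> cop lt_in fi lt_jn fj; rewrite -e_mod // => eq_fe.
have n_gt0 : 0 < n by case: (n) lt_in.
set r := l %% n in eq_fe; have lt_rn : r < n by rewrite ltn_mod.
pose k' := inv_mod k n; have k'K : k' * k = 1 %[mod n] by rewrite mulnC inv_modP.
pose g h := (k' * h + k' * a) %% n < r.
exists k', (k' * a), r; split; last 1 first.
- apply: (bitsum_mod_inj (g := g) lt_in fi lt_jn fj).
  (* Since a + b = n a, multiplication by 2^b undoes the rotation by [a]. *)
  pose b := n.-1 * a.
  have abE : a + b = n * a by rewrite /b -mulSn prednK.
  have -> : bitsum n f = 2 ^ b * e r k %[mod 2 ^ n - 1].
    rewrite -modnMmr -eq_fe modnMmr mulnA -expnD addnC abE.
    by rewrite -modnMml -[n * a]add0n expn2_modD modnMml mul1n.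
  have -> : 2 ^ b * e r k = \sum_(h < n) (h < r) * 2 ^ (k * h + b).
    rewrite /e big_mkord (big_ord_widen n (fun h => 2 ^ (h * k))) //; last by lia.
    rewrite big_distrr /= big_mkcond; apply: eq_bigr => h _.
    by case: ifP => _; rewrite ?mul0n // mul1n -expnD addnC mulnC.
  (* Substituting k h + b for the digit index turns membership in [g] into h < r, because k'(k h +
     b) + k' a = h modulo [n]. *)
  rewrite /bitsum -(sum_affine b (fun h => g h * 2 ^ h) cop).
  apply: eq_mod_sum => h; rewrite -[RHS]modnMmr expn2_mod modnMmr.
  congr ((nat_of_bool _ * _) %% _); rewrite /g -mulnDr.
  rewrite -modnMmr modnDml -addnA [b + a]addnC abE [n * a]mulnC modnMmr.
  rewrite [k * h + _]addnC mulnDr !mulnA modnMDl.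
  by rewrite -modnMml k'K modnMml mul1n modn_small.
- have: coprime (k' * k) n by rewrite -coprime_modl k'K coprime_modl coprime1n.
  by rewrite coprimeMl => /andP[].
- exact: ltnW.
Qed.

(** * Counting in affine images of intervals *)

Lemma affine_interval_card (n u v r : nat) (f : nat -> bool) :
  affine_interval n f u v r -> \sum_(i < n) f i = r.
Proof.
case=> cop le_rn fE.
under eq_bigr => i _ do rewrite fE //.
rewrite (sum_affine v (fun i => nat_of_bool (i < r)) cop).
by rewrite (sum_indicator_interval 0 le_rn) subn0.
Qed.

(** The affine map turns the shift by [c] into the shift by m = u c. A point of [0, r) leaves under
    it iff r - m <= i < n - m, since a point that wraps around lands below itself. With truncated
    subtraction the count is min(m, n - m, r, n - r). *)
Lemma affine_interval_exits (n u v r c : nat) (f : nat -> bool) :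
  0 < n -> affine_interval n f u v r ->
  \sum_(i < n) (f i && ~~ f ((i + c) %% n)) =
  minn r (n - (u * c) %% n) - (r - (u * c) %% n).
Proof.
move=> n_gt0 [cop le_rn fE]; set m := (u * c) %% n.
have lt_mn : m < n by rewrite ltn_mod.
pose F i := nat_of_bool ((i < r) && ~~ ((i + m) %% n < r)).
transitivity (\sum_(i < n) F ((u * i + v) %% n)).
  apply: eq_bigr => i _; rewrite /F !fE ?ltn_mod //.
  congr (nat_of_bool (_ && ~~ (_ < _))).
  by rewrite -modnDml modnMmr modnDml modnDm mulnDr addnAC.
rewrite (sum_affine v F cop).
under eq_bigr => i _.
  rewrite /F modn_addl_small //; last exact: ltnW.
  have -> : (i < r) && ~~ ((if i + m < n then i + m else i + m - n) < r)
            = (r - m <= i < minn r (n - m)) by have := ltn_ord i; case: ifP; lia.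
  over.
by rewrite sum_indicator_interval //; lia.
Qed.

Lemma double_step (n u : nat) : 0 < n ->
  (u * 2) %% n = if 2 * (u %% n) < n then 2 * (u %% n) else 2 * (u %% n) - n.
Proof.
move=> n_gt0; rewrite -modnMml muln2 -addnn modn_addl_small ?ltn_mod //.
  by rewrite mul2n -addnn.
by rewrite ltnW // ltn_mod.
Qed.

(** Two exits for shift 1 force u = 2 or -2 modulo [n]; then shift 2 moves by 4 or -4 and has four
    exits. *)
Lemma not_affine_exits23 (n u v r : nat) (f : nat -> bool) :
  10 < n -> affine_interval n f u v r -> 3 < r < n - 3 ->
  \sum_(i < n) (f i && ~~ f ((i + 1) %% n)) = 2 ->
  \sum_(i < n) (f i && ~~ f ((i + 2) %% n)) <> 3.
Proof.
move=> n_gt10 aff; have n_gt0 : 0 < n by lia.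
have := ltn_pmod u n_gt0.
rewrite !(affine_interval_exits _ n_gt0 aff) muln1 double_step //.
by case: ifP; lia.
Qed.

(** With x exits for shift 1, counting gives r = x + 2 and n - r >= x + 2, so x = min(m, n - m) for
    m = u mod n. Three exits for shift 2 need r = 3 or n - r = 3, where x <= 1 allows at most two,
    or n - 2x = 3, against n >= 2x + 4. *)
Lemma not_affine_pairs2_exits3 (n u v r : nat) (f : nat -> bool) :
  10 < n -> odd n -> affine_interval n f u v r ->
  \sum_(i < n) (f i && f ((i + 1) %% n)) = 2 ->
  2 <= \sum_(i < n) (~~ f i && ~~ f ((i + 1) %% n)) ->
  \sum_(i < n) (f i && ~~ f ((i + 2) %% n)) <> 3.
Proof.
move=> n_gt10 odd_n aff; have n_gt0 : 0 < n by lia.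
have card_f := affine_interval_card aff.
have exits1 := affine_interval_exits 1 n_gt0 aff.
have exits2 := affine_interval_exits 2 n_gt0 aff.
have split_f : \sum_(i < n) (f i && f ((i + 1) %% n)) +
    \sum_(i < n) (f i && ~~ f ((i + 1) %% n)) = r.
  by rewrite -card_f -big_split; apply: eq_bigr => i _ /=; case: (f i); case: (f _).
have split_n : \sum_(i < n) (~~ f i && ~~ f ((i + 1) %% n)) +
    \sum_(i < n) (f i && ~~ f ((i + 1) %% n)) + r = n.
  have cop1 : coprime 1 n by rewrite coprime1n.
  rewrite -card_f -(sum_affine 1 (fun i => nat_of_bool (f i)) cop1) -!big_split /=.
  rewrite -[RHS]card_ord -sum1_card; apply: eq_bigr => i _ /=.
  by rewrite mul1n; case: (f i); case: (f _).
move: exits1 exits2 split_f split_n; rewrite muln1 double_step //.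
have := ltn_pmod u n_gt0; case: aff => _ le_rn _.
set x := \sum_(i < n) _; set y := \sum_(i < n) _; set z := \sum_(i < n) _.
set w := \sum_(i < n) _.
by case: ifP; lia.
Qed.

(** * The digits of the odd Niho exponent and of its inverse *)

Definition niho_bits (s i : nat) : bool := (i < 2 * s + 1) || (i == 3 * s + 2).

(** The digits of 2^s times the inverse of d, that is, of (1 + 2^(2s+2) + 2^(3s+2)) / 3 modulo 2^n -
    1. *)
Definition niho_inv_bits (s i : nat) : bool :=
  if odd s then
    [|| (i < 2 * s + 2) && ~~ odd i, i == 3 * s + 2 | (3 * s + 2 < i) && ~~ odd i]
  else
    [|| i < 2, (i < 2 * s + 2) && odd i |
        (2 * s + 2 <= i < 3 * s + 2) && ~~ odd i].

Lemma niho_odd_bitsum (s : nat) :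
  niho_odd (2 * s + 1) = bitsum (4 * s + 3) (niho_bits s).
Proof.
rewrite /niho_odd (_ : (3 * (2 * s + 1) + 1) %/ 2 = 3 * s + 2); last by lia.
rewrite (@bitsum_trunc (3 * s + 3)); first last.
- by rewrite /niho_bits => i; lia.
- by lia.
rewrite (_ : 3 * s + 3 = (3 * s + 2).+1) ?bitsumS; last by lia.
rewrite {2}/niho_bits eqxx orbT mul1n (@bitsum_trunc (2 * s + 1)); first last.
- by rewrite /niho_bits => i; lia.
- by lia.
rewrite bitsum_ones => [|i Hi]; last by rewrite /niho_bits Hi.
have : 0 < 2 ^ (2 * s + 1) by rewrite expn_gt0.
by lia.
Qed.

(** Modulo 3, 2^n - 1 is 1 and the right side is 1 for odd [s], 0 for even [s]. So exact division by
    3 requires adding twice the modulus for odd [s] and nothing for even [s]. The digits are summed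
    block by block from below. *)
Lemma bitsum_niho_inv (s : nat) :
  3 * bitsum (4 * s + 3) (niho_inv_bits s) = 1 + 2 ^ (2 * s + 2) + 2 ^ (3 * s + 2)
    %[mod 2 ^ (4 * s + 3) - 1].
Proof.
set f := niho_inv_bits s.
case: (boolP (odd s)) => odd_s.
- have fE i : f i = [|| (i < 2 * s + 2) && ~~ odd i,
      i == 3 * s + 2 | (3 * s + 2 < i) && ~~ odd i].
    by rewrite /f /niho_inv_bits odd_s.
  have B1 : 3 * bitsum (2 * s + 2) f + 1 = 2 ^ (2 * s + 2).
    have := @bitsum_alternate 0 (s + 1) false f.
    rewrite /= !addn0 add0n mulnDr => -> => [|i]; last by rewrite fE; lia.
    by rewrite {1}/bitsum big_ord0.
  have B2 : bitsum (3 * s + 2) f = bitsum (2 * s + 2) f.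
    by apply: bitsum_trunc => [|i]; rewrite ?fE; lia.
  have B3 : bitsum (3 * s + 4) f = bitsum (3 * s + 2) f + 3 * 2 ^ (3 * s + 2).
    have -> : 3 * s + 4 = (3 * s + 2).+2 by lia.
    rewrite !bitsumS (_ : f _); last by rewrite fE; lia.
    rewrite (_ : f _); last by rewrite fE; lia.
    by rewrite expnS; lia.
  have B4 : 3 * bitsum (4 * s + 3) f + 8 * 2 ^ (3 * s + 2) =
      3 * bitsum (3 * s + 4) f + 2 * 2 ^ (4 * s + 3).
    have := @bitsum_alternate (3 * s + 4) s./2 false f.
    have -> : 3 * s + 4 + 2 * s./2 = 4 * s + 3 by lia.
    have -> : odd (3 * s + 4) by lia.
    rewrite /= !addn1 [2 ^ (4 * s + 3).+1]expnS => <- => [|i]; last by rewrite fE; lia.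
    have -> : (3 * s + 4).+1 = 3 + (3 * s + 2) by lia.
    by rewrite (expnD 2 3).
  have pos : 0 < 2 ^ (4 * s + 3) by rewrite expn_gt0.
  have -> : 3 * bitsum (4 * s + 3) f =
      2 * (2 ^ (4 * s + 3) - 1) + (1 + 2 ^ (2 * s + 2) + 2 ^ (3 * s + 2)) by lia.
  by rewrite modnMDl.
- have fE i : f i = [|| i < 2, (i < 2 * s + 2) && odd i |
      (2 * s + 2 <= i < 3 * s + 2) && ~~ odd i].
    by rewrite /f /niho_inv_bits (negbTE odd_s).
  (* Digits 0 and 1 contribute 9 = 3 * 3; the alternating block starts at digit 3, whence 8 =
     2^3. *)
  have B1 : 3 * bitsum (2 * s + 2) f + 8 = 9 + 2 * 2 ^ (2 * s + 2).
    have := @bitsum_alternate 2 s true f.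
    rewrite /= [2 + _]addnC => -> => [|i]; last by rewrite fE; lia.
    rewrite bitsum_ones => [|i Hi]; last by rewrite fE Hi.
    by rewrite addn1 [2 ^ (_ + 2).+1]expnS.
  have B2 : 3 * bitsum (3 * s + 2) f + 2 ^ (2 * s + 2) =
      3 * bitsum (2 * s + 2) f + 2 ^ (3 * s + 2).
    have := @bitsum_alternate (2 * s + 2) s./2 false f.
    have -> : 2 * s + 2 + 2 * s./2 = 3 * s + 2 by lia.
    have -> : odd (2 * s + 2) = false by lia.
    by rewrite !addn0 => -> // i; rewrite fE; lia.
  have B3 : bitsum (4 * s + 3) f = bitsum (3 * s + 2) f.
    by apply: bitsum_trunc => [|i]; rewrite ?fE; lia.
  by congr (_ %% _); lia.
Qed.

Lemma niho_odd_mul (s : nat) :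
  niho_odd (2 * s + 1) * (1 + 2 ^ (2 * s + 2) + 2 ^ (3 * s + 2)) = 3 * 2 ^ s
    %[mod 2 ^ (4 * s + 3) - 1].
Proof.
rewrite /niho_odd (_ : (3 * (2 * s + 1) + 1) %/ 2 = 3 * s + 2); last by lia.
set y := 2 ^ s.
have yE c i : 2 ^ (c * s + i) = y ^ c * 2 ^ i by rewrite expnD [c * s]mulnC expnM.
rewrite !{}yE.
have y_gt0 : 0 < y by rewrite expn_gt0.
(* With y = 2^s the modulus is 8y^4 - 1; [q] is the quotient and 3y the remainder of the polynomial
   division by it. *)
pose q := 3 * y + 2 * y ^ 2 + 1.
suff -> : (y ^ 2 * 2 + y ^ 3 * 4 - 1) * (1 + y ^ 2 * 4 + y ^ 3 * 4) =
    q * (y ^ 4 * 8 - 1) + 3 * y by rewrite modnMDl.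
have y2_gt0 : 0 < y ^ 2 by rewrite expn_gt0 y_gt0.
have y4_gt0 : 0 < y ^ 4 by rewrite expn_gt0 y_gt0.
(* The same identity with all negative terms moved across, free of truncated subtraction. *)
have : (y ^ 2 * 2 + y ^ 3 * 4) * (1 + y ^ 2 * 4 + y ^ 3 * 4) + q =
    q * (y ^ 4 * 8) + 3 * y + (1 + y ^ 2 * 4 + y ^ 3 * 4).
  by rewrite /q !expnS expn0; lia.
set c := 1 + _ + _.
have [D ->] : exists D, y ^ 2 * 2 + y ^ 3 * 4 = D.+1.
  by exists (y ^ 2 * 2 + y ^ 3 * 4).-1; lia.
have [M ->] : exists M, y ^ 4 * 8 = M.+1 by exists (y ^ 4 * 8).-1; lia.
by rewrite !subn1 /=; lia.
Qed.

Lemma coprime_expn2_sub1 (n : nat) : coprime 2 (2 ^ n.+1 - 1).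
Proof. by rewrite coprime2n expnS; have : 0 < 2 ^ n by [rewrite expn_gt0]; lia. Qed.

Lemma coprime3_expn2_sub1 (n : nat) : odd n -> coprime 3 (2 ^ n - 1).
Proof.
move=> odd_n; rewrite prime_coprime // /dvdn.
have -> : n = (2 * n./2).+1 by lia.
have : 2 ^ (2 * n./2) = 1 %[mod 3] by rewrite expnM -modnXm exp1n.
by rewrite expnS; lia.
Qed.

(** A multiple of d is congruent to 3 * 2^s, which is a unit as [n] is odd. *)
Lemma coprime_niho_odd (s : nat) :
  coprime (niho_odd (2 * s + 1)) (2 ^ (4 * s + 3) - 1).
Proof.
have: coprime (3 * 2 ^ s) (2 ^ (4 * s + 3) - 1).
  rewrite coprimeMl coprime3_expn2_sub1 /=; last by lia.
  by rewrite coprimeXl // addn3 coprime_expn2_sub1.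
by rewrite -coprime_modl -niho_odd_mul coprime_modl coprimeMl => /andP[].
Qed.

Lemma niho_inv_bitsum (s : nat) :
  bitsum (4 * s + 3) (niho_inv_bits s) =
  2 ^ s * inv_mod (niho_odd (2 * s + 1)) (2 ^ (4 * s + 3) - 1)
    %[mod 2 ^ (4 * s + 3) - 1].
Proof.
have cop_d := coprime_niho_odd s.
set d := niho_odd _ in cop_d *; set M := _ - 1 in cop_d *.
have cop_3 : coprime 3 M by apply: coprime3_expn2_sub1; lia.
have cop_3d : coprime (3 * d) M by rewrite coprimeMl cop_3.
apply: (modn_mul2l_inj cop_3d).
rewrite mulnAC -modnMml bitsum_niho_inv modnMml mulnC niho_odd_mul.
by rewrite mulnACA -[RHS]modnMmr inv_modP // modnMmr muln1.
Qed.

(** * Neither digit set is affine *)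

(** The case n = 7 lies below the bound 10 < n of the counting arguments; all residues [u], [v] and
    all r <= 7 are tried. *)
Lemma not_affine_niho_small (u v r : nat) :
  ~ affine_interval 7 (niho_bits 1) u v r /\
  ~ affine_interval 7 (niho_inv_bits 1) u v r.
Proof.
pose bad f := all (fun u' => all (fun v' => all (fun r' =>
  has (fun i => f i != ((u' * i + v') %% 7 < r')) (iota 0 7))
  (iota 0 8)) (iota 0 7)) (iota 0 7).
suff not_affine f : bad f -> ~ affine_interval 7 f u v r.
  by split; apply: not_affine; vm_compute.
move=> bad_f [_ le_r7 fE].
have mem_mod x : x %% 7 \in iota 0 7 by rewrite mem_iota ltn_mod.
have /hasP[i] := allP (allP (allP bad_f _ (mem_mod u)) _ (mem_mod v)) r
  ltac:(by rewrite mem_iota).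
rewrite mem_iota => /= lt_i7.
by rewrite modnDmr -modnDml modnMml modnDml -fE ?eqxx.
Qed.

Lemma not_affine_niho_bits (s u v r : nat) :
  1 < s -> ~ affine_interval (4 * s + 3) (niho_bits s) u v r.
Proof.
move=> s_gt1 aff; set n := 4 * s + 3 in aff.
have card_f := affine_interval_card aff.
apply: (@not_affine_exits23 n u v r (niho_bits s)) => //.
- by rewrite /n; lia.
(* Four set digits and four clear ones give 3 < r < n - 3; 3s + 4 is below [n] because s > 1. *)
- apply/andP; split.
    rewrite -card_f; apply: (@sum_ge_size n _ [:: 0; 1; 2; 3]) => //=.
      by rewrite /n; lia.
    by rewrite /niho_bits; lia.
  have : 4 <= \sum_(i < n) ~~ niho_bits s i.
    apply: (@sum_ge_size n (fun i => ~~ niho_bits s i)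
              [:: 2 * s + 1; 2 * s + 2; 3 * s + 3; 3 * s + 4]) => /=.
    - by rewrite !inE; lia.
    - by rewrite /n; lia.
    - by rewrite /niho_bits; lia.
  have : \sum_(i < n) ~~ niho_bits s i + \sum_(i < n) niho_bits s i = n.
    rewrite -big_split -[RHS]card_ord -sum1_card; apply: eq_bigr => i _ /=.
    by case: (niho_bits s i).
  by rewrite card_f; lia.
- rewrite (@sum_eq_size n (fun i => niho_bits s i && ~~ niho_bits s ((i + 1) %% n))
             [:: 2 * s; 3 * s + 2]) //=.
  + by rewrite !inE; lia.
  + by rewrite /n; lia.
  + move=> i lt_in; rewrite modn_addl_small //; last by rewrite /n; lia.
    by rewrite !inE /niho_bits; case: ifP; rewrite /n in lt_in *; lia.
- rewrite (@sum_eq_size n (fun i => niho_bits s i && ~~ niho_bits s ((i + 2) %% n))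
             [:: 2 * s - 1; 2 * s; 3 * s + 2]) //=.
  + by rewrite !inE; lia.
  + by rewrite /n; lia.
  + move=> i lt_in; rewrite modn_addl_small //; last by rewrite /n; lia.
    by rewrite !inE /niho_bits; case: ifP; rewrite /n in lt_in *; lia.
Qed.

Lemma not_affine_niho_inv_bits (s u v r : nat) :
  1 < s -> ~ affine_interval (4 * s + 3) (niho_inv_bits s) u v r.
Proof.
move=> s_gt1 aff; set n := 4 * s + 3 in aff; set f := niho_inv_bits s in aff.
(* Adjacent set digits occur only where the parity of the alternation changes, once across the wrap
   from 4s + 2 to 0 for odd [s]. [pairs] and [exits] are complete lists, while [gaps] names just two
   positions inside the block of zeros. *)
pose pairs := if odd s then [:: 3 * s + 2; 4 * s + 2] else [:: 0; 2 * s + 1].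
pose gaps := if odd s then [:: 2 * s + 1; 2 * s + 2] else [:: 3 * s + 1; 3 * s + 2].
pose exits := if odd s then [:: 2 * s; 3 * s + 2; 4 * s + 2]
              else [:: 0; 2 * s + 1; 3 * s].
have addE c i : c < 3 -> i < n ->
    f ((i + c) %% n) = if i + c < n then f (i + c) else f (i + c - n).
  move=> c_lt3 lt_in; rewrite modn_addl_small //; last by rewrite /n; lia.
  by case: ifP.
apply: (@not_affine_pairs2_exits3 n u v r f) => //.
- by rewrite /n; lia.
- by rewrite /n; lia.
- rewrite (@sum_eq_size n (fun i => f i && f ((i + 1) %% n)) pairs).
  + by rewrite /pairs; case: ifP.
  + by rewrite /pairs; case: ifP => odd_s; rewrite /= !inE; lia.
  + by rewrite /pairs /n; case: ifP => odd_s /=; lia.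
  + move=> i lt_in; rewrite addE // /f /niho_inv_bits /pairs.
    by case: (boolP (odd s)) => odd_s; rewrite !inE;
      case: ifP; rewrite /n in lt_in *; lia.
- apply: leq_trans (@sum_ge_size n (fun i => ~~ f i && ~~ f ((i + 1) %% n)) gaps _ _ _).
  + by rewrite /gaps; case: ifP.
  + by rewrite /gaps; case: ifP => odd_s; rewrite /= !inE; lia.
  + by rewrite /gaps /n; case: ifP => odd_s /=; lia.
  + rewrite /gaps; case: (boolP (odd s)) => odd_s; rewrite /= andbT;
      rewrite !addE /f /niho_inv_bits ?odd_s ?(negbTE odd_s) /n; try lia;
      by do !case: ifP; lia.
- rewrite (@sum_eq_size n (fun i => f i && ~~ f ((i + 2) %% n)) exits).
  + by rewrite /exits; case: ifP.
  + by rewrite /exits; case: ifP => odd_s; rewrite /= !inE; lia.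
  + by rewrite /exits /n; case: ifP => odd_s /=; lia.
  + move=> i lt_in; rewrite addE // /f /niho_inv_bits /exits.
    by case: (boolP (odd s)) => odd_s; rewrite !inE;
      case: ifP; rewrite /n in lt_in *; lia.
Qed.

Theorem theorem9 (t n k : nat) :
  1 < t -> odd t -> n = 2 * t + 1 -> gcdn k n = 1 ->
  forall l : nat,
    ~ cyclotomic_equiv n (inv_mod (niho_odd t) (2 ^ n - 1)) (e l k).
Proof.
move=> t_gt1 odd_t n_def /eqP cop_kn l.
have [s t_def] : exists s, t = 2 * s + 1 by exists t./2; lia.
have {}n_def : n = 4 * s + 3 by lia.
have s_gt0 : 0 < s by lia.
have [lt_0n lt_1n lt_2n] : [/\ 0 < n, 2 * s + 1 < n & 3 * s + 1 < n] by split; lia.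
have bits0 : niho_bits s 0 by rewrite /niho_bits addn1.
have bits1 : ~~ niho_bits s (2 * s + 1) by rewrite /niho_bits; lia.
have inv_bits0 : niho_inv_bits s 0 by rewrite /niho_inv_bits addn2; case: ifP.
have inv_bits1 : ~~ niho_inv_bits s (3 * s + 1).
  by rewrite /niho_inv_bits; case: ifP; lia.
have s_cases : s = 1 \/ 1 < s by lia.
have cop_d := coprime_niho_odd s.
have bits_inv := niho_inv_bitsum s.
have d_bits := niho_odd_bitsum s.
rewrite -t_def -n_def in cop_d bits_inv d_bits.
set d := niho_odd t in cop_d bits_inv d_bits *.
have dK := inv_modP cop_d; set x := inv_mod d _ in bits_inv dK *.
case=> a [eq_a | [cop_x eq_a]].
(* The exponent (n - 1) s cancels the rotation by [s] in [bits_inv], as (n - 1) s + s = n s. *)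
- have eq_f : 2 ^ (a + n.-1 * s) * bitsum n (niho_inv_bits s) = e l k
      %[mod 2 ^ n - 1].
    rewrite -modnMmr bits_inv modnMmr mulnA -expnD -addnA [_ * s + s]addnC -mulSn.
    rewrite prednK; last by rewrite n_def addn3.
    by rewrite -modnMml expn2_modD modnMml.
  have [u [v [r]]] := bitsum_e_affine cop_kn lt_0n inv_bits0 lt_2n inv_bits1 eq_f.
  rewrite n_def; case: s_cases => [->|/not_affine_niho_inv_bits]; last exact.
  by case: (not_affine_niho_small u v r).
(* The inverse of [x] modulo 2^n - 1 is d again, so the digits of d itself decide this case. *)
- have eq_f : 2 ^ a * bitsum n (niho_bits s) = e l k %[mod 2 ^ n - 1].
    rewrite -eq_a -d_bits -modnMmr -[RHS]modnMmr; congr ((_ * _) %% _).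
    by apply: (modn_mul2l_inj cop_x); rewrite inv_modP // mulnC.
  have [u [v [r]]] := bitsum_e_affine cop_kn lt_0n bits0 lt_1n bits1 eq_f.
  rewrite n_def; case: s_cases => [->|/not_affine_niho_bits]; last exact.
  by case: (not_affine_niho_small u v r).
Qed.
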